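(* Let $(R,\mathfrak{m})$ be a local Gaussian ring. If $\mathfrak{m}\neq 0$ and each element of $\mathfrak{m}$ is a zero divisor, then the weak global dimension of $R$ is at least $3$.
   Context: All rings are commutative with unit; $(R,\mathfrak{m})$ local means that $\mathfrak{m}$ is the unique maximal ideal of $R$ ($R$ not necessarily Noetherian). For a polynomial $f\in R[x]$, the content $c(f)$ is the ideal of $R$ generated by the coefficients of $f$. The ring $R$ is called Gaussian if $c(f)c(g)=c(fg)$ for all $f,g\in R[x]$. An element $x\in R$ is a zero divisor if $xy=0$ for some $y\in R$, $y\neq 0$. The flat dimension $\mathrm{fd}(M)$ of an $R$-module $M$ is the smallest $n$ such that there is a resolution $0\to F_n\to\cdots\to F_0\to M\to 0$ by flat $R$-modules, and $\infty$ if no finite such resolution exists. The weak global dimension of $R$ is $\sup\{\mathrm{fd}(M)\mid M \text{ an } R\text{-module}\}$ (possibly $\infty$). *)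

(* Defs.v *)
From HB Require Import structures.
From mathcomp Require Import all_boot all_order all_algebra.
From mathcomp Require Import boolp classical_sets constructive_ereal.
From mathcomp Require Import freeg.

Set Implicit Arguments.
Unset Strict Implicit.
Unset Printing Implicit Defensive.

Import Order.TTheory GRing.Theory Num.Theory.

Local Open Scope classical_set_scope.
Local Open Scope ring_scope.
Local Open Scope quotient_scope.

(* The ideal predicates of ring_quotient.v only describe proper ideals, whereas
   the content of a polynomial may be the whole ring. *)
Section Ideals.
Variable R : comNzRingType.
Implicit Types (I J m : set R) (f g : {poly R}).

Definition ideal I : Prop :=
  [/\ I 0, forall x y, I x -> I y -> I (x + y) & forall a x, I x -> I (a * x)].

Definition ideal_gen (X : set R) : set R := smallest ideal X.

Definition ideal_mul I J : set R := ideal_gen [set x * y | x in I & y in J].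

Definition maximal_ideal m : Prop :=
  [/\ ideal m, m <> setT &
      forall I, ideal I -> m `<=` I -> I = m \/ I = setT].

Definition local_ring m : Prop :=
  maximal_ideal m /\ forall I, maximal_ideal I -> I = m.

Definition content f : set R := ideal_gen (range (fun i : nat => f`_i)).

Definition zero_divisor (x : R) : Prop := exists2 y : R, y != 0 & x * y = 0.

End Ideals.

Definition gaussian (R : comNzRingType) : Prop :=
  forall f g : {poly R}, ideal_mul (content f) (content g) = content (f * g).

Section Span.
Variables (R : comNzRingType) (V : lmodType R).

Definition submodule (U : set V) : Prop :=
  U 0 /\ forall (a : R) (u v : V), U u -> U v -> U (a *: u + v).

Definition submod_span (X : set V) : V -> bool := fun v => `[< smallest submodule X v >].

Variable X : set V.

Lemma submod_spanP v : reflect (smallest submodule X v) (v \in submod_span X).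
Proof. exact: asboolP. Qed.

Lemma submodule_span : submodule (smallest submodule X).
Proof.
split=> [U [[U0 _] _] //|a u v Xu Xv U UX].
by case: (UX) => -[_ UD] _; exact: (UD a u v (Xu U UX) (Xv U UX)).
Qed.

Lemma submod_span_closed : submod_closed (submod_span X).
Proof.
have [s0 sD] := submodule_span; split; first exact/submod_spanP.
by move=> a u v /submod_spanP su /submod_spanP sv; apply/submod_spanP; exact: sD.
Qed.

HB.instance Definition _ :=
  GRing.isSubmodClosed.Build R V (submod_span X) submod_span_closed.

Lemma mem_submod_span v : X v -> v \in submod_span X.
Proof. by move=> Xv; apply/submod_spanP => U [_]; apply. Qed.

Definition submod_span_zmod : zmodClosed V := GRing.ZmodClosed.clone V (submod_span X) _.

(* Quotient.quot only provides the additive group; the module structure is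
   added below. *)
Definition quot_span := Quotient.quot submod_span_zmod.

HB.instance Definition _ := GRing.Zmodule.on quot_span.

Definition quot_pi (v : V) : quot_span := \pi_(Quotient.quot submod_span_zmod) v.

Definition quot_repr (q : quot_span) : V := repr (q : Quotient.quot submod_span_zmod).

Lemma quot_reprK q : quot_pi (quot_repr q) = q.
Proof. exact: reprK. Qed.

Lemma quot_piE u v : (quot_pi u = quot_pi v) <-> u - v \in submod_span X.
Proof. by rewrite Quotient.idealrBE; split=> /eqP. Qed.

Lemma quot_piD u v : quot_pi (u + v) = quot_pi u + quot_pi v.
Proof. exact: (raddfD (\pi_(Quotient.quot submod_span_zmod))). Qed.

Definition quot_scale (a : R) (q : quot_span) : quot_span :=
  quot_pi (a *: quot_repr q).

Lemma quot_piZ a v : quot_pi (a *: v) = quot_scale a (quot_pi v).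
Proof.
apply/quot_piE; rewrite -scalerBr; apply: rpredZ.
by apply/quot_piE; rewrite quot_reprK.
Qed.

Fact quot_scaleA a b q :
  quot_scale a (quot_scale b q) = quot_scale (a * b) q.
Proof. by rewrite -[q]quot_reprK -!quot_piZ scalerA. Qed.

Fact quot_scale1 : left_id 1 quot_scale.
Proof. by move=> q; rewrite -[q]quot_reprK -quot_piZ scale1r. Qed.

Fact quot_scaleDr : right_distributive quot_scale +%R.
Proof.
move=> a p q; rewrite -[p]quot_reprK -[q]quot_reprK.
by rewrite -quot_piD -!quot_piZ scalerDr quot_piD.
Qed.

Fact quot_scaleDl q : {morph quot_scale^~ q : a b / a + b}.
Proof.
by move=> a b; rewrite /= -[q]quot_reprK -!quot_piZ scalerDl quot_piD.
Qed.

HB.instance Definition _ := GRing.Zmodule_isLmodule.Build R quot_span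
  quot_scaleA quot_scale1 quot_scaleDr quot_scaleDl.

Lemma quot_pi_linear : linear quot_pi.
Proof. by move=> a u v; rewrite quot_piD quot_piZ. Qed.

HB.instance Definition _ :=
  GRing.isLinear.Build R V quot_span _ quot_pi quot_pi_linear.

End Span.

(* The free module on M * N modulo the bilinearity relations; its universal
   property is given by tens_bilinear, tensor_lift_tens and tensor_ext. *)
Section Tensor.
Variables (R : comNzRingType) (M N : lmodType R).

Inductive tensor_rel : set {freeg (M * N) / R} :=
| tensor_relDl m1 m2 n :
    tensor_rel (<< (m1 + m2, n) >> - (<< (m1, n) >> + << (m2, n) >>))
| tensor_relDr m n1 n2 :
    tensor_rel (<< (m, n1 + n2) >> - (<< (m, n1) >> + << (m, n2) >>))
| tensor_relZl a m n :
    tensor_rel (<< (a *: m, n) >> - a *: << (m, n) >>)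
| tensor_relZr a m n :
    tensor_rel (<< (m, a *: n) >> - a *: << (m, n) >>).

Definition tensor : lmodType R := quot_span tensor_rel.

Definition tens (m : M) (n : N) : tensor := quot_pi tensor_rel << (m, n) >>.

Definition bilinear_map (P : lmodType R) (b : M -> N -> P) : Prop :=
  (forall m, linear (b m)) /\ (forall n, linear (b^~ n)).

Lemma tens_bilinear : bilinear_map tens.
Proof.
have tD n : {morph tens^~ n : x y / x + y}.
  move=> x y; rewrite /tens -raddfD.
  by apply/quot_piE/mem_submod_span; constructor.
have tDr m : {morph tens m : x y / x + y}.
  move=> x y; rewrite /tens -raddfD.
  by apply/quot_piE/mem_submod_span; constructor.
split=> [m a x y|n a x y] /=.
  rewrite tDr; congr (_ + _); rewrite /tens -linearZ.
  by apply/quot_piE/mem_submod_span; constructor.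
rewrite tD; congr (_ + _); rewrite /tens -linearZ.
by apply/quot_piE/mem_submod_span; constructor.
Qed.

Definition tensor_lift (P : lmodType R) (b : M -> N -> P) (t : tensor) : P :=
  fglift (fun p => b p.1 p.2) (quot_repr t).

Lemma fglift_linear (P : lmodType R) (K : choiceType) (h : K -> P) :
  linear (fglift h : {freeg K / R} -> P).
Proof.
have hD := lift_is_additive h.
pose hA : {additive {freeg K / R} -> P} := HB.pack (fglift h)
  (GRing.isZmodMorphism.Build _ _ (fglift h) hD).
move=> a u v; rewrite -[fglift h (_ + _)]/(hA (a *: u + v)) raddfD /=.
congr (_ + _); rewrite /GRing.scale /= /fgscale -[fglift h]/(hA : _ -> _).
rewrite raddf_sum -[X in _ = _ *: hA X]freeg_sumE raddf_sum scaler_sumr.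
by apply: eq_bigr => x _; rewrite /= !liftU scalerA.
Qed.

Section Universal.
Variables (P : lmodType R) (b : M -> N -> P).
Hypothesis bb : bilinear_map b.

Lemma tensor_lift_pi v :
  tensor_lift b (quot_pi tensor_rel v) = fglift (fun p => b p.1 p.2) v.
Proof.
rewrite /tensor_lift; set h := fglift _.
have hlin : linear h by exact: fglift_linear.
have hB u w : h (u - w) = h u - h w.
  by rewrite -[- w]scaleN1r addrC hlin scaleN1r addrC.
have hD u w : h (u + w) = h u + h w.
  by rewrite -[u]scale1r hlin !scale1r.
have h0 : h 0 = 0 by rewrite -(subrr 0) hB subrr.
have hZ a u : h (a *: u) = a *: h u.
  by rewrite -[a *: u]addr0 hlin h0 addr0.
suff hker u : u \in submod_span tensor_rel -> h u = 0.
  apply/eqP; rewrite -subr_eq0 -hB; apply/eqP/hker.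
  by apply/quot_piE; rewrite quot_reprK.
move=> /submod_spanP /(_ [set u | h u = 0]); apply; split.
  by split=> //= a w z hw hz; rewrite hlin hw hz scaler0 addr0.
case: bb => bl br.
have hU m n : h << (m, n) >> = b m n by rewrite /h liftU scale1r.
have blD m x y : b m (x + y) = b m x + b m y.
  by rewrite -[x]scale1r bl !scale1r.
have brD n x y : b (x + y) n = b x n + b y n.
  by have := br n 1 x y; rewrite !scale1r.
have bl0 m : b m 0 = 0.
  by apply: (addrI (b m 0)); rewrite -blD !addr0.
have br0 n : b 0 n = 0.
  by apply: (addrI (b 0 n)); rewrite -brD !addr0.
move=> _ [m1 m2 n|m n1 n2|a m n|a m n] /=; rewrite hB ?hD ?hZ !hU.
- by rewrite brD subrr.
- by rewrite blD subrr.
- by have := br n a m 0; rewrite /= !addr0 br0 addr0 => ->; rewrite subrr.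
- by have := bl m a n 0; rewrite /= !addr0 bl0 addr0 => ->; rewrite subrr.
Qed.

Lemma tensor_lift_tens m n : tensor_lift b (tens m n) = b m n.
Proof. by rewrite tensor_lift_pi liftU scale1r. Qed.

Lemma tensor_lift_linear : linear (tensor_lift b).
Proof.
move=> a t u; rewrite -[t]quot_reprK -[u]quot_reprK -linearP.
by rewrite !tensor_lift_pi fglift_linear.
Qed.

End Universal.

Lemma tensor_ext (P : lmodType R) (g h : {linear tensor -> P}) :
  (forall m n, g (tens m n) = h (tens m n)) -> g =1 h.
Proof.
move=> gh t; rewrite -[t]quot_reprK -[quot_repr t]freeg_sumE.
rewrite !linear_sum; apply: eq_bigr => -[m n] _.
set c := coeff _ _; have -> : << c *g (m, n) >> = c *: << (m, n) >>.
  by apply/eqP/freeg_eqP => x; rewrite coeffZ !coeffU mul1r.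
by rewrite !linearZ /= gh.
Qed.

End Tensor.

(* For f linear this is the map id_M (x) f, characterised by tensor_mapE. *)
Definition tensor_map (R : comNzRingType) (M A B : lmodType R) (f : A -> B) :
    tensor M A -> tensor M B :=
  tensor_lift (fun m a => tens m (f a)).

Section TensorMap.
Variables (R : comNzRingType) (M A B : lmodType R) (f : {linear A -> B}).

Lemma tensor_map_bilinear :
  bilinear_map (fun (m : M) (a : A) => tens m (f a)).
Proof.
have [tl tr] := tens_bilinear M B.
by split=> [m a x y|a c x y] /=; [rewrite linearP tl|rewrite tr].
Qed.

Lemma tensor_mapE m a : tensor_map f (tens m a) = tens m (f a) :> tensor M B.
Proof. exact: (tensor_lift_tens tensor_map_bilinear). Qed.

HB.instance Definition _ := GRing.isLinear.Build R (tensor M A) (tensor M B) _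
  (tensor_map f) (tensor_lift_linear tensor_map_bilinear).

End TensorMap.

Section FlatDimension.
Variable R : comNzRingType.

Definition flat (M : lmodType R) : Prop :=
  forall (A B : lmodType R) (f : {linear A -> B}),
    injective f -> injective (tensor_map f : tensor M A -> tensor M B).

(* There is an exact sequence 0 -> F n -> ... -> F 0 -> M -> 0 of flat
   modules, extended by zero modules in degrees greater than n. *)
Definition has_flat_resolution (M : lmodType R) (n : nat) : Prop :=
  exists (F : nat -> lmodType R) (d : forall i, {linear F i.+1 -> F i})
         (e : {linear F 0%N -> M}),
    [/\ forall i, flat (F i),
        forall i, (n < i)%N -> forall x : F i, x = 0,
        range e = setT,
        [set x | e x = 0] = range (d 0%N) &
        forall i, [set x | d i x = 0] = range (d i.+1)].

(* Values in {0, 1, 2, ...} and +oo. *)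
Definition flat_dim (M : lmodType R) : \bar int :=
  infimum +oo%E [set (n%:Z)%:E | n in [set n | has_flat_resolution M n]].

End FlatDimension.

Definition weak_gldim (R : comNzRingType) : \bar int :=
  supremum -oo%E [set fd | exists M : lmodType R, fd = flat_dim M].

(* infimum and supremum return an arbitrary value on nonempty sets without
   infimum or supremum; this never happens here. *)
Section WellDefined.
Variable R : comNzRingType.

Lemma flat_dim_infimum (M : lmodType R) :
  infimums [set (n%:Z)%:E | n in [set n | has_flat_resolution M n]]
    (flat_dim M).
Proof.
rewrite /flat_dim /infimum; case: ifPn => [/eqP ->|/set0P[_ [n Mn _]]].
  by split=> [x []|x _]; rewrite ?leey.
have ex : exists n, `[< has_flat_resolution M n >] by exists n; exact/asboolP.
apply: xgetPex; case: (ex_minnP ex) => m /asboolP Mm mmin.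
exists (m%:Z)%:E; split=> [_ [k Mk <-]|x lbx].
  by rewrite lee_fin lez_nat; apply: mmin; apply/asboolP.
by apply: lbx; exists m.
Qed.

Lemma flat_dim_nat (M : lmodType R) :
  flat_dim M = +oo%E \/ exists n : nat, flat_dim M = (n%:Z)%:E.
Proof.
have [lb glb] := flat_dim_infimum M.
have ge0 : (0%:E <= flat_dim M)%E.
  by apply: glb => _ [k _ <-]; rewrite lee_fin.
by case: (flat_dim M) ge0 => [[n|n]| |] //= _; [right; exists n|left].
Qed.

Lemma weak_gldim_supremum :
  supremums [set fd | exists M : lmodType R, fd = flat_dim M] (weak_gldim R).
Proof.
rewrite /weak_gldim /supremum; set S := [set fd | _].
have ne : S (flat_dim (R^o : lmodType R)) by exists R^o.
case: ifPn => [/eqP E|_]; first by rewrite E in ne.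
apply: xgetPex.
have ubge b : ubound S b -> b = +oo%E \/ exists n : nat, b = (n%:Z)%:E.
  move=> /(_ _ ne); case: (flat_dim_nat R^o) => [->|[n ->]].
    by rewrite leye_eq => /eqP; left.
  by case: b => [[m|m]| |] //= _; [right; exists m|left].
have [ex|nex] := pselect (exists n : nat, `[< ubound S (n%:Z)%:E >]).
  case: (ex_minnP ex) => m /asboolP Sm mmin; exists (m%:Z)%:E; split=> // b Sb.
  case: (ubge _ Sb) => [->|[k bk]]; first exact: leey.
  by rewrite bk lee_fin lez_nat; apply: mmin; apply/asboolP; rewrite -bk.
exists +oo%E; split=> [x _|b Sb]; first exact: leey.
case: (ubge _ Sb) => [->//|[k bk]]; case: nex; exists k.
by apply/asboolP; rewrite -bk.
Qed.

End WellDefined.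

(* Main.v *)
Require Import Defs.
From HB Require Import structures.
From mathcomp Require Import all_boot all_order all_algebra.
From mathcomp Require Import boolp classical_sets constructive_ereal.
From mathcomp Require Import ring.

Set Implicit Arguments.
Unset Strict Implicit.
Unset Printing Implicit Defensive.

Import Order.TTheory GRing.Theory Num.Theory.

Local Open Scope classical_set_scope.
Local Open Scope ring_scope.

(** Suppose that every module has a flat resolution of length at most 2.

    Applied to [R/a], this makes the annihilator [I] of every [a] idempotent.
    The conceptual reason is that [Tor_3 (R/a, R/a) = Tor_1 (R/a, I) = I / I^2],
    by shifting dimensions along [0 -> aR -> R -> R/a -> 0] and
    [0 -> I -> R -> aR -> 0].  The computation is done on elements
    ([flat_resolution_idempotent_annihilator]): the free complex
    [R -> R -> R/a] is lifted to the flat resolution [F2 -> F1 -> F0], and the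
    equational criterion for flatness ([flat_equational]), used once in each of
    [F2], [F1] and [F0], brings the finitely many relations involved back to
    scalars, where they express each element of [I] as a combination of products
    of two elements of [I].

    In a local Gaussian ring the squares of two elements are always comparable
    for divisibility, and the one that divides the other also divides the product
    ([sqr_comparable]); hence every element of [I^2] is of the form [c s^2] with
    [s] in [I].  If moreover all annihilators are idempotent, a nonzero [a] with
    [a^2 = 0] cannot exist: [a] lies in its own annihilator, so [a = c s^2] with
    [a s = 0]; then [s^2] annihilates [c s], hence [s^2 = d u^2] for some [u]
    with [c s u = 0], and these two relations force [c s^2 = 0]
    ([mul_sqr_eq0]).

    Finally, if [x y = 0] in a local Gaussian ring then [x^2 = 0] or [y^2 = 0]
    ([mul_eq0_sqr_eq0]).  A nonzero [x] in the maximal ideal and a nonzero [y]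
    with [x y = 0] therefore contradict the absence of square-zero elements. *)

(** * Ideals, annihilators and local rings *)

Section Ideals.
Variable R : comNzRingType.
Implicit Types (I : set R) (a x y : R).

Definition invertible x : Prop := exists y, x * y = 1.

Definition annihilator a : set R := [set x | a * x = 0].

Lemma ideal_annihilator a : ideal (annihilator a).
Proof.
rewrite /annihilator; split=> /= [|x y xa ya|b x xa]; first by rewrite mulr0.
  by rewrite mulrDr xa ya addr0.
by rewrite mulrCA xa mulr0.
Qed.

Lemma ideal_sum I n (x : 'I_n -> R) :
  ideal I -> (forall i, I (x i)) -> I (\sum_i x i).
Proof. by case=> I0 ID _ Ix; elim/big_ind: _. Qed.

Lemma ideal_gen_ideal (X : set R) : ideal (ideal_gen X).
Proof.
split=> [I [[] //]|x y Xx Xy|a x Xx] I [idI XI].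
  by case: (idI) => _ + _; apply; [exact: Xx|exact: Xy].
by case: (idI) => _ _; apply; exact: Xx.
Qed.

Lemma sub_ideal_gen (X : set R) : X `<=` ideal_gen X.
Proof. by move=> x Xx I [_]; apply. Qed.

Lemma ideal_multiples x : ideal [set a * x | a in setT].
Proof.
split=> [|_ _ [a _ <-] [b _ <-]|b _ [a _ <-]].
- by exists 0; rewrite ?mul0r.
- by exists (a + b); rewrite ?mulrDl.
- by exists (b * a); rewrite ?mulrA.
Qed.

(** Zorn's lemma on the proper ideals containing [I]. *)
Lemma proper_ideal_le_maximal I : ideal I -> ~ I 1 ->
  exists2 m, maximal_ideal m & I `<=` m.
Proof.
move=> idI I1.
(* The empty set is admitted because it is the union of the empty chain. *)
pose P (J : set R) := J = set0 \/ [/\ ideal J, ~ J 1 & I `<=` J].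
have [F FP Ftot|J [PJ Jmax]] := @Zorn_bigcup R P.
  have [allF0|] := pselect (forall J, F J -> J = set0).
    by left; apply/seteqP; split=> // x [J /allF0 ->].
  move=> /existsNP[J0 /not_implyP[FJ0 J0n]]; right.
  have FJ J x : F J -> J x -> [/\ ideal J, ~ J 1 & I `<=` J].
    by move=> /FP[->|//].
  have [id0 _ IJ0] : [/\ ideal J0, ~ J0 1 & I `<=` J0] by case: (FP _ FJ0).
  split.
  - split; first by exists J0 => //; case: id0.
      move=> x y [J JF Jx] [L LF Ly].
      have [[_ JD _] _ _] := FJ _ _ JF Jx; have [[_ LD _] _ _] := FJ _ _ LF Ly.
      case: (Ftot _ _ JF LF) => sub.
        by exists L => //; apply: LD => //; exact: sub.
      by exists J => //; apply: JD => //; exact: sub.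
    move=> a x [J JF Jx]; exists J => //.
    by case: (FJ _ _ JF Jx) => -[_ _ JM] _ _; exact: JM.
  - by move=> [J JF J1]; case: (FJ _ _ JF J1).
  - by move=> x /IJ0; exists J0.
have PI : P I by right; split.
have I0 : I 0 by case: idI.
have [J0|[idJ J1 IJ]] := PJ.
  case: (Jmax I) => //; rewrite J0 properEneq; split=> //; apply/eqP => E.
  by rewrite -E in I0.
exists J => //; split=> // [JT|L idL JL]; first by apply: J1; rewrite JT.
have [L1|L1] := pselect (L 1).
  right; apply/seteqP; split=> // x _; case: idL => _ _ /(_ x 1 L1).
  by rewrite mulr1.
left; apply: contrapT => LJ; apply: (Jmax L).
  by rewrite properEneq; split=> //; apply/eqP => /esym.
by right; split=> // x /IJ/JL.
Qed.

(** A noninvertible element generates a proper ideal, which lies in the only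
    maximal ideal; two noninvertible elements thus never add up to 1.  This
    dichotomy is all that the arithmetic below uses of locality. *)
Lemma local_invertible (m : set R) x :
  local_ring m -> invertible x \/ invertible (1 - x).
Proof.
move=> [[[_ mD mM] mT _] m_uniq].
have in_m y : ~ invertible y -> m y.
  move=> yn; have [|n maxn yn'] := proper_ideal_le_maximal (ideal_multiples y).
    by move=> [a _ ay]; apply: yn; exists a; rewrite mulrC.
  by rewrite -(m_uniq _ maxn); apply: yn'; exists 1; rewrite ?mul1r.
apply: contrapT => /not_orP[/in_m mx /in_m m1x]; apply: mT.
apply/seteqP; split=> // y _; rewrite -[y]mulr1; apply: (mM).
by rewrite -[1](subrK x); exact: mD.
Qed.

End Ideals.

(** * Squares in local Gaussian rings *)

(** Lets [ring] use the hypothesis [x = y] with multiplier [k], for equations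
    whose sides are not monomials. *)
Lemma eq_of_comb (R : comNzRingType) (k x y u v : R) :
  x = y -> u - v = k * (x - y) -> u = v.
Proof. by move=> -> /eqP; rewrite subrr mulr0 subr_eq0 => /eqP. Qed.
Arguments eq_of_comb {R} k {x y u v}.

Section Gaussian.
Variable R : comNzRingType.
Hypothesis R_local : forall x : R, invertible x \/ invertible (1 - x).
Hypothesis R_gaussian : gaussian R.
Implicit Types a b c d : R.

(** The Gaussian property for [a X + b] and [c X + d]: the product [a d] of two
    coefficients lies in the content of the product polynomial.  All later facts
    come from a choice of [c] and [d] that makes this content small. *)
Lemma gaussian_linear a b c d :
  exists p q r, a * d = p * (a * c) + q * (a * d + b * c) + r * (b * d).
Proof.
pose f := Poly [:: b; a]; pose g := Poly [:: d; c].
have : content (f * g) (a * d).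
  rewrite -R_gaussian; apply: sub_ideal_gen; exists a.
    by apply: sub_ideal_gen; exists 1%N; rewrite // coef_Poly.
  by exists d => //; apply: sub_ideal_gen; exists 0%N; rewrite // coef_Poly.
move=> /(_ [set x | exists p q r, x = p * (a * c) + q * (a * d + b * c) + r * (b * d)]).
apply; split.
  split=> /=; first by exists 0, 0, 0; ring.
    move=> _ _ [p [q [r ->]]] [p' [q' [r' ->]]].
    by exists (p + p'), (q + q'), (r + r'); ring.
  by move=> k _ [p [q [r ->]]]; exists (k * p), (k * q), (k * r); ring.
move=> _ [i _ <-]; rewrite coefM /=.
case: i => [|[|[|i]]].
- exists 0, 0, 1; rewrite big_ord1 !coef_Poly /=; ring.
- exists 0, 1, 0; rewrite !big_ord_recl big_ord0 !coef_Poly /= /bump /=; ring.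
- exists 1, 0, 0; rewrite !big_ord_recl big_ord0 !coef_Poly /= /bump /=; ring.
exists 0, 0, 0; rewrite big1 => [|j _]; first by ring.
rewrite !coef_Poly; case: (ltnP j 2) => j2.
  rewrite mulrC nth_default ?mul0r //= leq_subRL ?leq_ord // addn2.
  by apply: (@leq_trans 3).
by rewrite nth_default ?mul0r.
Qed.

(** [(a X + b) (b X - r a) = (b^2 - r a^2) X = 0], while [r a^2] is a product
    of coefficients. *)
Lemma sqr0_of_dvd a b r : a * b = 0 -> b ^+ 2 = r * a ^+ 2 -> b ^+ 2 = 0.
Proof.
move=> ab0 bE; have [p [q [s E]]] := gaussian_linear a b b (- r * a).
rewrite bE; apply/eqP; rewrite -oppr_eq0; apply/eqP.
have -> : - (r * a ^+ 2) = a * (- r * a) by ring.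
rewrite {}E ab0 (_ : b * (- r * a) = - r * (a * b)); last by ring.
rewrite ab0 (_ : a * (- r * a) + b * b = b ^+ 2 - r * a ^+ 2); last by ring.
by rewrite bE subrr !mulr0 !addr0.
Qed.

(** [(a X + b) (b X - a) = (b^2 - a^2) X], so [a^2] is a multiple
    [q (a^2 - b^2)].  As [q] or [1 - q] is invertible, one of the squares divides
    the other, and the previous lemma applies. *)
Lemma mul_eq0_sqr_eq0 a b : a * b = 0 -> a ^+ 2 = 0 \/ b ^+ 2 = 0.
Proof.
move=> ab0; have [p [q [s E]]] := gaussian_linear a b b (- a).
have {}E : (1 - q) * a ^+ 2 = - q * b ^+ 2.
  by apply: (eq_of_comb (-1) E); apply: (eq_of_comb (s - p) ab0); ring.
case: (R_local q) => -[y qy]; [right|left].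
  apply: (sqr0_of_dvd (r := - y * (1 - q)) ab0).
  by apply: (eq_of_comb y E); apply: (eq_of_comb (- b ^+ 2) qy); ring.
apply: (@sqr0_of_dvd b a (- y * q)); first by rewrite mulrC.
by apply: (eq_of_comb y E); apply: (eq_of_comb (- a ^+ 2) qy); ring.
Qed.

(** The product [(a X + b) (a X - b)] gives [a b = x a^2 + y b^2].  Then
    [(a X + b) (y b X + x a)] has all its coefficients divisible by [a b], so
    that [x a^2 = s a b] and [y b^2 = t a b], where [(s + t) a b = a b]; now [s]
    or [1 - s] is invertible. *)
Lemma mul_dvd_sqr a b :
  exists u, a * b = u * a ^+ 2 \/ a * b = u * b ^+ 2.
Proof.
have [p [q [r E0]]] := gaussian_linear a b a (- b).
pose x := - p; pose y := r.
have abE : a * b = x * a ^+ 2 + y * b ^+ 2.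
  by rewrite /x /y; apply: (eq_of_comb (-1) E0); ring.
have [p1 [q1 [r1 E1]]] := gaussian_linear a b (y * b) (x * a).
have [p2 [q2 [r2 E2]]] := gaussian_linear b a (x * a) (y * b).
pose s := p1 * y + q1 + r1 * x; pose t := p2 * x + q2 + r2 * y.
have sE : x * a ^+ 2 = s * (a * b)
  by rewrite /s; apply: (eq_of_comb 1 E1); apply: (eq_of_comb (- q1) abE); ring.
have tE : y * b ^+ 2 = t * (a * b)
  by rewrite /t; apply: (eq_of_comb 1 E2); apply: (eq_of_comb (- q2) abE); ring.
have stE : (1 - s) * (a * b) = t * (a * b).
  rewrite mulrBl mul1r -tE -sE {1}abE; ring.
have [[s' ss']|[s' ss']] := R_local s.
  exists (s' * x); left.
  by rewrite -mulrA sE mulrA [s' * s]mulrC ss' mul1r.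
exists (s' * y); right.
by rewrite -mulrA tE -stE mulrA [s' * _]mulrC ss' mul1r.
Qed.

(** If [a b = u a^2] then [a (b - u a) = 0], so [a^2 = 0] or
    [(b - u a)^2 = 0], and the latter expands to [b^2 = u^2 a^2]. *)
Lemma sqr_comparable a b :
  (exists u t, a * b = u * a ^+ 2 /\ b ^+ 2 = t * a ^+ 2) \/
  (exists u t, a * b = u * b ^+ 2 /\ a ^+ 2 = t * b ^+ 2).
Proof.
have half c d u : c * d = u * c ^+ 2 ->
    (exists t, d ^+ 2 = t * c ^+ 2) \/ c ^+ 2 = 0.
  move=> cd; have : c * (d - u * c) = 0 by apply: (eq_of_comb 1 cd); ring.
  case/mul_eq0_sqr_eq0 => [|E]; first by right.
  left; exists (u ^+ 2).
  by apply: (eq_of_comb 1 E); apply: (eq_of_comb (2 * u) cd); ring.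
have [u [abE|abE]] := mul_dvd_sqr a b.
  have [[t bE]|a0] := half _ _ _ abE; first by left; exists u, t.
  by right; exists 0, 0; rewrite abE a0 !mulr0 mul0r.
have [|[t aE]|b0] := half b a u; first by rewrite mulrC.
  by right; exists u, t.
by left; exists 0, 0; rewrite abE b0 !mulr0 mul0r.
Qed.

(** A sum of terms [c s^2] has the same form, since one of the squares divides
    all the others. *)
Lemma ideal_sqr_elt (J : set R) x : ideal J -> ideal_mul J J x ->
  exists c s, J s /\ x = c * s ^+ 2.
Proof.
move=> [J0 _ _] /(_ [set x | exists c s, J s /\ x = c * s ^+ 2]); apply.
split; first split=> /=.
- by exists 0, 0; rewrite mul0r.
- move=> _ _ [c [s [Js ->]]] [d [t [Jt ->]]].
  have [[u [v [_ vE]]]|[u [v [_ vE]]]] := sqr_comparable s t.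
    by exists (c + d * v), s; rewrite vE; split=> //; ring.
  by exists (d + c * v), t; rewrite vE; split=> //; ring.
- by move=> a _ [c [s [Js ->]]]; exists (a * c), s; rewrite mulrA.
move=> _ [s Js [t Jt <-]].
have [[u [v [-> _]]]|[u [v [-> _]]]] := sqr_comparable s t.
  by exists u, s.
by exists u, t.
Qed.

(** In the main case [s u = g u^2], so [u (s - g u) = 0]; unless [u^2 = 0], this
    gives [s^2 = g^2 u^2 = g (s u)], and [c s u = 0] concludes.  The case
    where [s^2] divides [u^2] is similar. *)
Lemma mul_sqr_eq0 c d s u : s ^+ 2 = d * u ^+ 2 -> c * s * u = 0 ->
  c * s ^+ 2 = 0.
Proof.
move=> sE csu.
have [[g [h [suE uE]]]|[g [h [suE _]]]] := sqr_comparable s u.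
  have : s * (u - g * s) = 0 by apply: (eq_of_comb 1 suE); ring.
  case/mul_eq0_sqr_eq0 => [->|E]; first by rewrite mulr0.
  have uE' : u ^+ 2 = g ^+ 2 * s ^+ 2
    by apply: (eq_of_comb 1 E); apply: (eq_of_comb (2 * g) suE); ring.
  have csg : c * g * s ^+ 2 = 0 by rewrite -csu -!mulrA suE.
  by rewrite sE uE'; apply: (eq_of_comb (d * g) csg); ring.
have : u * (s - g * u) = 0 by apply: (eq_of_comb 1 suE); ring.
case/mul_eq0_sqr_eq0 => [u0|E]; first by rewrite sE u0 !mulr0.
have sE' : s ^+ 2 = g ^+ 2 * u ^+ 2
    by apply: (eq_of_comb 1 E); apply: (eq_of_comb (2 * g) suE); ring.
have csg : c * g * u ^+ 2 = 0 by rewrite -csu -!mulrA suE.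
by rewrite sE'; apply: (eq_of_comb g csg); ring.
Qed.

Lemma sqr0_eq0_of_idempotent_annihilators a :
    (forall b, annihilator b `<=` ideal_mul (annihilator b) (annihilator b)) ->
  a ^+ 2 = 0 -> a = 0.
Proof.
move=> idem a0.
have [c [s [as0 aE]]] := ideal_sqr_elt (ideal_annihilator a) (idem a _ a0).
have csn : annihilator (c * s) (s ^+ 2).
  by apply: (eq_of_comb 1 as0); apply: (eq_of_comb (- s) aE); ring.
have [d [u [csu sE]]] := ideal_sqr_elt (ideal_annihilator (c * s)) (idem _ _ csn).
by rewrite aE (mul_sqr_eq0 sE csu).
Qed.

End Gaussian.

(** * The equational criterion for flatness *)

Lemma linear_comb (R : comNzRingType) (U V : lmodType R) (f : U -> V) n
    (c : 'I_n -> R) (v : 'I_n -> U) :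
  linear f -> f (\sum_i c i *: v i) = \sum_i c i *: f (v i).
Proof.
move=> lf; pose F : {linear U -> V} := HB.pack f (GRing.isLinear.Build _ _ _ _ _ lf).
rewrite -[f]/(F : U -> V) linear_sum; apply: eq_bigr => i _; exact: linearZ.
Qed.

Section EquationalCriterion.
Variables (R : comNzRingType) (M : lmodType R) (n p : nat) (A : 'M[R]_(n, p)).

(** [A] maps row vectors of length [n] to row vectors of length [p]; [coimage]
    stands for its image, and flatness is applied to the injection of [coimage]
    into ['rV_p]. *)
Let ker : set 'rV[R]_n := [set k | k *m A = 0].
Let coimage : lmodType R := quot_span ker.

Lemma row_ker_span k : k \in submod_span ker -> k *m A = 0.
Proof.
move=> /submod_spanP /(_ ker); apply; split=> //; split; first exact: mul0mx.
by move=> a u v; rewrite /ker /= mulmxDl -scalemxAl => -> ->; rewrite scaler0 addr0.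
Qed.

Let coimage_map (q : coimage) : 'rV[R]_p := quot_repr q *m A.

Lemma coimage_map_pi v : coimage_map (quot_pi ker v) = v *m A.
Proof.
apply/eqP; rewrite -subr_eq0 -mulmxBl; apply/eqP/row_ker_span/quot_piE.
exact: quot_reprK.
Qed.

Lemma coimage_map_linear : linear coimage_map.
Proof.
move=> a u v; rewrite -[u]quot_reprK -[v]quot_reprK -linearP.
by rewrite !coimage_map_pi mulmxDl scalemxAl.
Qed.

HB.instance Definition _ := GRing.isLinear.Build R coimage 'rV[R]_p _
  coimage_map coimage_map_linear.

Lemma coimage_map_inj : injective coimage_map.
Proof.
move=> u v; rewrite -[u]quot_reprK -[v]quot_reprK !coimage_map_pi => uv.
by apply/quot_piE/mem_submod_span; rewrite /ker /= mulmxBl uv subrr.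
Qed.

Let simple (v : 'rV[R]_n) (w : M) : {ffun 'I_n -> M} := [ffun i => v 0 i *: w].

Let simple_linearl w : linear (simple^~ w).
Proof.
move=> a u v; apply/ffunP => i; rewrite /simple !ffunE !mxE scalerDl.
by rewrite -scalerA.
Qed.

Let simple_linearr v : linear (simple v).
Proof.
move=> a w z; apply/ffunP => i; rewrite /simple !ffunE scalerDr.
by rewrite !scalerA mulrC.
Qed.

(** The submodule spanned by [U] is the image of [M (x) ker] in [M^n]. *)
Let U : set {ffun 'I_n -> M} :=
  [set u | exists k w, k *m A = 0 /\ u = simple k w].

(** Induces [M (x) coimage -> M^n / (M (x) ker)], an inverse to the map given by
    right exactness of the tensor product. *)
Let tensor_to_quot (w : M) (q : coimage) : quot_span U :=
  quot_pi U (simple (quot_repr q) w).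

Lemma tensor_to_quot_pi w v :
  tensor_to_quot w (quot_pi ker v) = quot_pi U (simple v w).
Proof.
set r := quot_repr (quot_pi ker v).
apply/quot_piE; have -> : simple r w - simple v w = simple (r - v) w.
  by apply/ffunP => i; rewrite /simple !ffunE !mxE scalerBl.
apply: mem_submod_span; exists (r - v), w; split=> //.
apply: row_ker_span; apply/quot_piE; exact: quot_reprK.
Qed.

Lemma tensor_to_quot_bilinear : bilinear_map tensor_to_quot.
Proof.
split=> [w a u v|q a w z].
  rewrite -[u]quot_reprK -[v]quot_reprK -linearP !tensor_to_quot_pi simple_linearl.
  by rewrite linearP.
by rewrite /tensor_to_quot simple_linearr linearP.
Qed.

(** The relations say that [x], as an element of [M (x) coimage], becomes zero in
    [M (x) R^p].  By flatness it is already zero, so [x] comes from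
    [M (x) ker]. *)
Lemma flat_equational (x : 'I_n -> M) : flat M ->
    (forall l, \sum_i A i l *: x i = 0) ->
  exists r (Q : 'M[R]_(r, n)) (w : 'I_r -> M),
    Q *m A = 0 /\ forall i, x i = \sum_j Q j i *: w j.
Proof.
move=> flatM Ax.
have [tl tr] := @tens_bilinear R M 'rV[R]_p.
pose t : tensor M coimage := \sum_i tens (x i) (quot_pi ker (delta_mx 0 i)).
have t0 : t = 0.
  apply: (flatM _ _ coimage_map coimage_map_inj); rewrite linear0 linear_sum.
  transitivity (\sum_i \sum_l A i l *: (tens (x i) (delta_mx 0 l) : tensor M 'rV[R]_p)).
    apply: eq_bigr => i _; transitivity (tens (x i) (row i A) : tensor M 'rV[R]_p).
      by rewrite [LHS]tensor_mapE rowE -coimage_map_pi.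
    rewrite [row i A]row_sum_delta (linear_comb _ _ (tl _)).
    by apply: eq_bigr => l _; rewrite mxE.
  rewrite exchange_big big1 // => l _.
  rewrite -(linear_comb (fun i => A i l) x (tr _)) Ax.
  by have /= := tr (delta_mx 0 l) (-1) 0 0; rewrite scaler0 addr0 scaleN1r addNr.
have xU : finfun x \in submod_span U.
  rewrite -[finfun x]subr0; apply/quot_piE; rewrite [RHS]linear0.
  pose B : {linear tensor M coimage -> quot_span U} :=
    HB.pack (tensor_lift tensor_to_quot)
    (GRing.isLinear.Build _ _ _ _ _ (tensor_lift_linear tensor_to_quot_bilinear)).
  transitivity (B t); last by rewrite t0 linear0.
  rewrite /t linear_sum.
  transitivity (\sum_i quot_pi U (simple (delta_mx 0 i) (x i))).
    rewrite -linear_sum; congr (quot_pi U _); apply/ffunP => i.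
    rewrite sum_ffunE ffunE (bigD1 i) //= big1 => [|j ji].
      by rewrite ffunE mxE !eqxx scale1r addr0.
    by rewrite ffunE mxE eqxx eq_sym (negbTE ji) scale0r.
  apply: eq_bigr => i _; rewrite -tensor_to_quot_pi.
  exact/esym/(tensor_lift_tens tensor_to_quot_bilinear).
pose W : set {ffun 'I_n -> M} := [set u | exists r (Q : 'M[R]_(r, n)) (w : 'I_r -> M),
    Q *m A = 0 /\ forall i, u i = \sum_j Q j i *: w j].
have [r [Q [w [QA xE]]]] : W (finfun x).
  move/submod_spanP: xU => /(_ W); apply; split; last first.
    move=> _ [k [w [kA ->]]]; exists 1%N, k, (fun=> w); split=> // i.
    by rewrite big_ord1 ffunE.
  split.
    exists 0%N, 0, (fun=> 0); split=> [|i]; first exact: mul0mx.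
    by rewrite big_ord0 ffunE.
  move=> a u v [r [Q [w [QA uE]]]] [s [S [z [SA vE]]]].
  exists (r + s)%N, (col_mx (a *: Q) S).
  exists (fun j => match split j with inl j => w j | inr j => z j end).
  split=> [|i].
    by rewrite mul_col_mx -scalemxAl QA SA scaler0 col_mx0.
  rewrite !ffunE big_split_ord uE vE scaler_sumr; congr (_ + _).
    apply: eq_bigr => j _; rewrite col_mxEu mxE scalerA.
    by rewrite -[lshift s j]/(unsplit (inl j)) unsplitK.
  apply: eq_bigr => j _; rewrite col_mxEd.
  by rewrite -[rshift r j]/(unsplit (inr j)) unsplitK.
by exists r, Q, w; split=> // i; rewrite -xE ffunE.
Qed.

End EquationalCriterion.

(** * Flat resolutions and annihilators *)

Section CyclicModule.
Variables (R : comNzRingType) (a : R).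

Definition cyclic_quot : lmodType R := quot_span ([set a] : set R^o).

Lemma cyclic_quot_pi_eq0 (v : R^o) :
  quot_pi [set (a : R^o)] v = 0 <-> exists t, v = t * a.
Proof.
rewrite -[0 in X in X <-> _](linear0 (quot_pi [set (a : R^o)])) quot_piE subr0.
split=> [/submod_spanP /(_ [set u | exists t, u = t * a]) | [t ->]].
  apply; split=> [|_ ->]; last by exists 1; rewrite mul1r.
  split=> [|b _ _ [t ->] [u ->]]; first by exists 0; rewrite mul0r.
  by exists (b * t + u); rewrite mulrDl -mulrA.
rewrite -[t * a]/(t *: (a : R^o)); apply: rpredZ.
exact: mem_submod_span.
Qed.

(** Lift [1], then [a], then an [x] with [a x = 0] through the resolution:
    [e f0 = 1], [d f1 = a f0], [d f2 = x f1].  As [d : F2 -> F1] is injective,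
    [a f2 = 0].  If the [F i] were projective, a chain map from the resolution
    back to [R -> R -> R/a] would conclude; the equational criterion provides the
    values of such a map on the finitely many elements that matter. *)
Lemma flat_resolution_idempotent_annihilator n :
    (n <= 2)%N -> has_flat_resolution cyclic_quot n ->
  annihilator a `<=` ideal_mul (annihilator a) (annihilator a).
Proof.
move=> n2 [F [d [e [flatF F0 esurj exact0 exactS]]]] x; rewrite /annihilator /= => ax0.
pose piM := quot_pi [set (a : R^o)].
have ker0 z : e z = 0 -> exists z', d 0%N z' = z.
  move=> ez; have : [set u | e u = 0] z by [].
  by rewrite exact0 => -[z' _ <-]; exists z'.
have ed0 z : e (d 0%N z) = 0.
  suff : [set u | e u = 0] (d 0%N z) by [].
  by rewrite exact0; exists z.
have kerS i z : d i z = 0 -> exists z', d i.+1 z' = z.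
  move=> dz; have : [set u | d i u = 0] z by [].
  by rewrite exactS => -[z' _ <-]; exists z'.
have dd i z : d i (d i.+1 z) = 0.
  suff : [set u | d i u = 0] (d i.+1 z) by [].
  by rewrite exactS; exists z.
have d1_inj z : d 1%N z = 0 -> z = 0.
  by case/kerS => z' <-; rewrite (F0 3 _ z') ?linear0.
have [f0 ef0] : exists f0, e f0 = piM 1.
  have : range e (piM 1) by rewrite esurj.
  by case=> f0 _ <-; exists f0.
have [f1 df1] : exists f1, d 0%N f1 = a *: f0.
  apply: ker0; rewrite linearZ ef0 -linearZ; apply/cyclic_quot_pi_eq0.
  by exists 1; rewrite mulrC.
have [f2 df2] : exists f2, d 1%N f2 = x *: f1.
  by apply: kerS; rewrite linearZ /= df1 scalerA mulrC ax0 scale0r.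
(* [F 2]: [f2] is a combination of the [g i] with coefficients killed by [a]. *)
have [|q [Y [g [YA f2E]]]] :=
    @flat_equational R _ _ _ (const_mx a : 'M_(1, 1)) (fun=> f2) (flatF 2).
  move=> l; rewrite big_ord1 mxE; apply: d1_inj.
  by rewrite linearZ /= df2 scalerA ax0 scale0r.
pose y i := Y i 0.
have ay i : a * y i = 0.
  by move/matrixP/(_ i 0): YA; rewrite !mxE big_ord1 mxE mulrC.
(* [F 1]: the relation [x f1 = sum_i y_i d(g_i)] is resolved by elements [w];
   index 0 stands for [f1], the others for the cycles [d(g_i)]. *)
pose z (i : 'I_q.+1) := if unlift ord0 i is Some j then d 1%N (g j) else f1.
pose A1 : 'M_(q.+1, 1) := \col_i (if unlift ord0 i is Some j then - y j else x).
have [|r [Q [w [QA zE]]]] :=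
    @flat_equational R _ _ _ A1 z (flatF 1%N).
  move=> l; rewrite big_ord_recl !mxE /z unlift_none -df2 (f2E 0) linear_sum -big_split.
  by rewrite big1 // => i _; rewrite mxE liftK linearZ /= scaleNr subrr.
have Qx j : Q j 0 * x = \sum_i Q j (lift ord0 i) * y i.
  move/matrixP/(_ j 0): QA; rewrite !mxE big_ord_recl !mxE unlift_none => /eqP.
  rewrite addr_eq0 => /eqP ->; rewrite -sumrN; apply: eq_bigr => i _.
  by rewrite mxE liftK mulrN opprK.
(* [F 0]: the relations expressing [d f1 = a f0] and [d (d g_i) = 0] in terms
   of the [d (w j)]; index 0 stands for [f0]. *)
pose V (i : 'I_r.+1) := if unlift ord0 i is Some j then d 0%N (w j) else f0.
pose A2 : 'M_(r.+1, q.+1) :=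
  \matrix_(i, l) (if unlift ord0 i is Some j then - Q j l else a *+ (l == 0)).
have [|s [B [v [BA VE]]]] :=
    @flat_equational R _ _ _ A2 V (flatF 0%N).
  move=> l; rewrite big_ord_recl !mxE /V unlift_none.
  transitivity ((a *+ (l == 0)) *: f0 - d 0%N (z l)).
    congr (_ + _); rewrite zE linear_sum -sumrN; apply: eq_bigr => i _.
    by rewrite mxE liftK linearZ scaleNr.
  apply/eqP; rewrite subr_eq0; apply/eqP; rewrite /z.
  by case: unliftP => [j|] ->; rewrite ?dd ?df1 ?scale0r.
(* The [v k] are sent to lifts [eps k] in [R] of their images in [R/a]: [f0] then
   goes to [1 - t a], and [d (w j)] to a multiple [p j * a], so that [w j] may be
   sent to [p j]. *)
pose eps k : R := quot_repr (e (v k)).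
have eV i : e (V i) = piM (\sum_k B k i * eps k).
  rewrite VE linear_sum [RHS]linear_sum; apply: eq_bigr => k _.
  by rewrite linearZ /= -[e (v k)]quot_reprK -linearZ.
have [t tE] : exists t, 1 - \sum_k B k 0 * eps k = t * a.
  apply/cyclic_quot_pi_eq0; rewrite linearB /= -[quot_pi _ _]/(piM 1) -ef0.
  by rewrite -[X in _ - X]/(piM _) -eV /V unlift_none subrr.
have pE j : exists p, \sum_k B k (lift ord0 j) * eps k = p * a.
  apply/cyclic_quot_pi_eq0.
  by rewrite -[LHS]/(piM _) -eV /V liftK.
have {pE} [p pE] := fin_all_exists pE.
have Qp l : (a *+ (l == 0)) * \sum_k B k 0 * eps k = a * \sum_j Q j l * p j.
  transitivity (\sum_j Q j l * (\sum_k B k (lift ord0 j) * eps k)); last first.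
    by rewrite mulr_sumr; apply: eq_bigr => j _; rewrite pE; ring.
  under [RHS]eq_bigr => j _ do rewrite mulr_sumr.
  rewrite [RHS]exchange_big mulr_sumr; apply: eq_bigr => k _ /=.
  move/matrixP/(_ k l): BA; rewrite !mxE big_ord_recl !mxE unlift_none => /eqP.
  rewrite addr_eq0 mulrA [_ * B k 0]mulrC => /eqP ->.
  rewrite -sumrN mulr_suml; apply: eq_bigr => j _.
  by rewrite mxE liftK; ring.
(* [c l] is the image of [z l]: the cycles go into the annihilator of [a], and
   [f1] goes to 1 modulo the annihilator and [a]. *)
pose c l := \sum_j Q j l * p j.
have ac i : a * c (lift ord0 i) = 0 by rewrite -Qp mul0r.
have ac0 : a * (1 - t * a - c 0) = 0.
  have := Qp 0; rewrite eqxx mulr1n -tE => E.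
  by rewrite mulrBr -E; ring.
have -> : x = x * (1 - t * a - c 0) + \sum_i y i * c (lift ord0 i).
  have -> : \sum_i y i * c (lift ord0 i) = x * c 0.
    rewrite [RHS]mulr_sumr; under [LHS]eq_bigr => i _ do rewrite mulr_sumr.
    rewrite [LHS]exchange_big; apply: eq_bigr => j _ /=.
    by rewrite mulrA [x * _]mulrC Qx mulr_suml; apply: eq_bigr => i _; ring.
  by apply: (eq_of_comb t ax0); ring.
have [_ ID _] := ideal_gen_ideal [set u * v | u in annihilator a & v in annihilator a].
apply: ID; first by apply: sub_ideal_gen; exists x => //; exists (1 - t * a - c 0).
apply: ideal_sum; first exact: ideal_gen_ideal.
by move=> i; apply: sub_ideal_gen; exists (y i); [exact: ay|exists (c (lift ord0 i))].
Qed.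

End CyclicModule.

(** The flat dimension is a greatest lower bound of naturals: were all flat
    resolutions of length at least 3, it would be at least 3. *)
Lemma flat_resolution_of_weak_gldim_lt3 (R : comNzRingType) (M : lmodType R) :
  ~ ((3 : int)%:E <= weak_gldim R)%E ->
  exists2 n, (n <= 2)%N & has_flat_resolution M n.
Proof.
move=> w3; have fdw : (flat_dim M <= weak_gldim R)%E.
  by have [+ _] := weak_gldim_supremum R; apply; exists M.
have {}w3 : (flat_dim M < (3 : int)%:E)%E.
  by rewrite ltNge; apply/negP => /le_trans /(_ fdw).
have [_ glb] := flat_dim_infimum M.
apply: contrapT => nex; move: w3; rewrite ltNge => /negP; apply.
apply: glb => _ [n Mn <-]; rewrite lee_fin lez_nat leqNgt; apply/negP => n2.
by apply: nex; exists n.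
Qed.

Theorem proposition3p6 (R : comNzRingType) (m : set R)
    (m_local : local_ring m) (R_gaussian : gaussian R)
    (m_neq0 : m <> [set 0])
    (m_zero_divisor : forall x : R, m x -> zero_divisor x) :
  ((3 : int)%:E <= weak_gldim R)%E.
Proof.
apply: contrapT => w3.
have R_local x := local_invertible x m_local.
have idem (a : R) : annihilator a `<=` ideal_mul (annihilator a) (annihilator a).
  have [n n2 fr] := flat_resolution_of_weak_gldim_lt3 (cyclic_quot a) w3.
  exact: flat_resolution_idempotent_annihilator n2 fr.
have sqr0 := sqr0_eq0_of_idempotent_annihilators R_local R_gaussian idem.
apply: m_neq0; apply/seteqP; split=> [x mx|_ ->]; last by case: m_local => -[[]].
have [y y0 xy0] := m_zero_divisor x mx.
have [/sqr0 //|/sqr0 y0'] := mul_eq0_sqr_eq0 R_local R_gaussian xy0.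
by rewrite y0' eqxx in y0.
Qed.
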